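(* Let $n\ge 2$, $\mathbb F$ a field, and $M\in M_{n+1}(\mathbb F)$ not a scalar multiple of the identity. The hyperplane $\mathcal H_M$ of $A_{n,\{1,n\}}(\mathbb F)$ is of spread type if and only if $M$ has no eigenvalue in $\mathbb F$ and $M$ satisfies: $M^2\mathbf x\in\langle \mathbf x,M\mathbf x\rangle$ for every nonzero $\mathbf x\in V$, and $\xi M^2\in\langle\xi,\xi M\rangle$ for every nonzero $\xi\in V^*$. If this is the case, then $\mathcal H_M=\mathcal H_{\mathfrak S_M}$, where $\mathfrak S_M=\{\langle[\mathbf x],[M\mathbf x]\rangle\}_{\mathbf x\in V\setminus\{0\}}$.
   Context: $V=\mathbb F^{n+1}$ (column vectors), $V^*$ its dual (row vectors), $\mathrm{PG}(n,\mathbb F)=\mathrm{PG}(V)$; $[\mathbf x]$ and $[\xi]$ denote the point and hyperplane represented by nonzero $\mathbf x\in V$, $\xi\in V^*$. $A_{n,\{1,n\}}(\mathbb F)$ is the point-line geometry whose points are the pairs $(p,H)$, $p$ a point and $H$ a hyperplane of $\mathrm{PG}(n,\mathbb F)$ with $p\in H$; lines are the sets $\{(p,H)\mid p\in\ell\}$ for a line $\ell\subseteq H$ with $H$ fixed, and $\{(p,H)\mid H\supseteq L\}$ for $L$ a codimension-$2$ subspace and fixed $p\in L$. A geometric hyperplane is a proper set of points which meets every line and contains every line meeting it in at least two points. For $M$ non-scalar, $\mathcal H_M$ is the set of points $([\mathbf x],[\xi])$ (so $\xi\mathbf x=0$) with $\xi M\mathbf x=0$, i.e. $\mathrm{trace}(M\,\mathbf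 x\xi)=0$; this is a geometric hyperplane (hyperplane of tensor type). A line-spread is a set of lines partitioning the points; a dual line-spread is a set $\mathfrak S^*$ of codimension-$2$ subspaces such that each hyperplane contains exactly one member. A line-spread $\mathfrak S$ admits a dual if some dual line-spread $\mathfrak S^*$ has the property that for each $L\in\mathfrak S^*$ the members of $\mathfrak S$ inside $L$ form a line-spread of $L$. For such $\mathfrak S$, with $\ell_p$ the member of $\mathfrak S$ through $p$, $\mathcal H_{\mathfrak S}=\{(p,H)\mid \ell_p\subseteq H\}$; a hyperplane of $A_{n,\{1,n\}}(\mathbb F)$ is of spread type if it equals $\mathcal H_{\mathfrak S}$ for some line-spread $\mathfrak S$ admitting a dual. *)

(* Defs.v *)
From mathcomp Require Import all_boot all_order all_algebra.
From mathcomp Require Import boolp classical_sets.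

Set Implicit Arguments.
Unset Strict Implicit.
Unset Printing Implicit Defensive.

Import GRing.Theory.
Local Open Scope classical_set_scope.
Local Open Scope ring_scope.

(* Subspaces of PG(V) are represented by the vector subspaces of V, so that    *)
(* projective dimension is one less than \dim.                                *)
Section ProjectiveGeometry.
Variables (F : fieldType) (V : vectType F).
Implicit Types (p l L H U : {vspace V}) (S D : set {vspace V}).
Implicit Types X Y : set ({vspace V} * {vspace V}).

Definition pg_point p : Prop := \dim p = 1%N.
Definition pg_line l : Prop := \dim l = 2%N.
Definition pg_hyperplane H : Prop := (\dim H).+1 = \dim {:V}.
Definition pg_codim2 L : Prop := (\dim L).+2 = \dim {:V}.

(* The point set of the geometry A_{n,{1,n}}. *)
Definition flag : set ({vspace V} * {vspace V}) :=
  [set a | [/\ pg_point a.1, pg_hyperplane a.2 & (a.1 <= a.2)%VS]].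

(* The lines of A_{n,{1,n}}, as sets of flags. *)
Definition flag_line : set (set ({vspace V} * {vspace V})) :=
  [set X |
    (exists l H, [/\ pg_line l, pg_hyperplane H, (l <= H)%VS &
       X = [set a | [/\ pg_point a.1, (a.1 <= l)%VS & a.2 = H]]])
    \/
    (exists p L, [/\ pg_point p, pg_codim2 L, (p <= L)%VS &
       X = [set a | [/\ a.1 = p, pg_hyperplane a.2 & (L <= a.2)%VS]]])].

Definition geometric_hyperplane X : Prop :=
  [/\ X `<` flag,
      forall Y, flag_line Y -> Y `&` X !=set0 &
      forall Y, flag_line Y ->
        (exists a b, [/\ a <> b, (Y `&` X) a & (Y `&` X) b]) -> Y `<=` X].

Definition line_spread U S : Prop :=
  (forall l, S l -> pg_line l /\ (l <= U)%VS) /\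
  (forall p, pg_point p -> (p <= U)%VS -> exists! l, S l /\ (p <= l)%VS).

Definition dual_line_spread D : Prop :=
  (forall L, D L -> pg_codim2 L) /\
  (forall H, pg_hyperplane H -> exists! L, D L /\ (L <= H)%VS).

Definition admits_dual S : Prop :=
  exists D, dual_line_spread D /\
    forall L, D L -> line_spread L [set l | S l /\ (l <= L)%VS].

(* When S is a line-spread, the l below is the unique member of S through p. *)
Definition spread_hyperplane S : set ({vspace V} * {vspace V}) :=
  [set a | flag a /\ exists l, [/\ S l, (a.1 <= l)%VS & (l <= a.2)%VS]].

Definition spread_type X : Prop :=
  geometric_hyperplane X /\
  exists S, [/\ line_spread {:V} S, admits_dual S & X = spread_hyperplane S].

End ProjectiveGeometry.

Section Matrices.
Variables (F : fieldType) (n : nat).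
Implicit Type M : 'M[F]_n.+1.

(* The hyperplane [xi] of PG(n, F) represented by the row vector xi. *)
Definition hyp_of (xi : 'rV[F]_n.+1) : {vspace 'cV[F]_n.+1} :=
  lker (linfun (mulmx xi)).

Definition tensor_hyperplane M :
    set ({vspace 'cV[F]_n.+1} * {vspace 'cV[F]_n.+1}) :=
  [set a | exists (x : 'cV[F]_n.+1) (xi : 'rV[F]_n.+1),
     [/\ x != 0, xi != 0, a = (<[x]>%VS, hyp_of xi),
         xi *m x = 0 & xi *m M *m x = 0]].

Definition spread_of_mx M : set {vspace 'cV[F]_n.+1} :=
  [set l | exists2 x : 'cV[F]_n.+1, x != 0 &
     l = (<[x]> + <[M *m x]>)%VS].

End Matrices.

(* Main.v *)
(** With [f : x |-> M x], the hyperplane [H_M] consists of the flags [(p, H)]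
    with [f p <= H].  If it equals [H_S] for a line-spread [S], then the
    hyperplanes containing [p + f p] are those containing the member of [S]
    through [p], so that member is [p + f p]; hence [p] is not fixed by [f] and
    the lines [p + f p] are [f]-stable.  A member [L] of the dual spread is a
    union of such lines, hence [f]-stable, and for [L <= H] this forces
    [L = H :&: f^-1 H].  Conversely the lines [p + f p] and the subspaces
    [H :&: f^-1 H] give the spread and its dual.  Stability of [H :&: f^-1 H]
    for [H = ker xi] says that [xi M^2] vanishes where [xi] and [xi M] do, which
    by duality is the condition on row vectors. *)

Require Import Defs.
From mathcomp Require Import all_boot all_order all_algebra.
From mathcomp Require Import boolp classical_sets.
From mathcomp Require Import zify.

Set Implicit Arguments.
Unset Strict Implicit.
Unset Printing Implicit Defensive.

Import GRing.Theory.
Local Open Scope classical_set_scope.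
Local Open Scope ring_scope.

(** * Points, hyperplanes and dimension counts in a vector space *)

Section Subspaces.
Variables (F : fieldType) (V : vectType F).
Implicit Types (p l H L U W : {vspace V}) (x v : V) (f : 'End(V)).

Lemma pg_point_vline x : x != 0 -> pg_point <[x]>%VS.
Proof. by move=> x0; rewrite /pg_point dim_vline x0. Qed.

Lemma sub_vline_eq p x : pg_point p -> x != 0 -> x \in p -> p = <[x]>%VS.
Proof.
move=> dp x0 xp; apply/esym/eqP.
by rewrite eqEdim -memvE xp dim_vline x0 dp.
Qed.

Lemma exists_nonzero U : (0 < \dim U)%N -> exists2 x, x != 0 & x \in U.
Proof.
move=> dU; exists (vpick U); last exact: memv_pick.
by rewrite vpick0 -dimv_eq0 -lt0n.
Qed.

Lemma pg_pointP p : pg_point p -> exists2 x, x != 0 & p = <[x]>%VS.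
Proof.
move=> dp; have [|x x0 xp] := @exists_nonzero p; first by rewrite dp.
by exists x => //; exact: sub_vline_eq.
Qed.

(** For [v] in [W] outside [U], adding to [U] a complement of [U + <[v]>] leaves out exactly the
    direction of [v]. *)
Lemma hyperplane_separation U W : ~~ (W <= U)%VS ->
  exists H, [/\ pg_hyperplane H, (U <= H)%VS & ~~ (W <= H)%VS].
Proof.
case/subvPn=> v vW vU; pose H := (U + (U + <[v]>)^C)%VS.
have Hv : (<[v]> + H = fullv)%VS.
  by rewrite addvA (addvC <[v]>%VS) addv_complf.
have := dimv_sum_cap U <[v]>%VS; have := dimv_sum_cap <[v]>%VS H; rewrite Hv.
have : (\dim H <= \dim U + \dim (U + <[v]>)^C)%N.
  by rewrite (dimv_add_leqif _ _).
rewrite dimv_compl dim_vline.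
have -> : v != 0 by apply: contraNneq vU => ->; exact: mem0v.
have -> : \dim (U :&: <[v]>) = 0%N.
  apply/eqP; rewrite dimv_eq0 -subv0; apply/subvP => w.
  rewrite memv_cap memv0 => /andP[wU /vlineP[k wE]]; move: wU; rewrite wE.
  have [->|k0 kvU] := eqVneq k 0; first by rewrite scale0r.
  by case/negP: vU; rewrite -(scalerK k0 v) memvZ.
have := dimvS (subvf (U + <[v]>)%VS).
move=> /= d1 d2 d3 d4.
have dH : (\dim H < \dim {:V})%N by lia.
have vH : v \notin H.
  apply: contraTN dH => vH; rewrite -leqNgt -Hv dimvS //.
  by rewrite subv_add -memvE vH subvv.
exists H; split; last by apply: contra vH => /subvP->.
  by rewrite /pg_hyperplane; lia.
exact: addvSl.
Qed.

(** A subspace is the intersection of the hyperplanes above it; this is how spread members are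
    recovered from flags. *)
Lemma subv_hyperplanes U W :
  (forall H, pg_hyperplane H -> (U <= H)%VS -> (W <= H)%VS) -> (W <= U)%VS.
Proof.
move=> UW; apply/negPn/negP => /hyperplane_separation[H [hH UH]].
by rewrite UW.
Qed.

Lemma exists_hyperplane U : (\dim U < \dim {:V})%N ->
  exists2 H, pg_hyperplane H & (U <= H)%VS.
Proof.
move=> dU; have [|H [hH UH _]] := @hyperplane_separation U fullv.
  by apply: contraTN dU => /dimvS; rewrite -leqNgt.
by exists H.
Qed.

Lemma dim_cap_hyperplane U H : pg_hyperplane H ->
  (\dim U <= (\dim (U :&: H)).+1)%N.
Proof.
rewrite /pg_hyperplane => hH; have := dimv_sum_cap U H.
by have := dimvS (subvf (U + H)%VS); lia.
Qed.

Lemma limg_subE f U W : (f @: U <= W)%VS = (U <= f @^-1: W)%VS.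
Proof.
apply/subvP/subvP => [fUW x xU | UfW _ /memv_imgP[x xU ->]].
  by rewrite -memv_preim fUW ?memv_img.
by rewrite memv_preim UfW.
Qed.

(** Rank-nullity on both sides: [U] and [U :&: f @^-1: H] contain the same part of the kernel, and
    intersecting [f @: U] with [H] costs at most one dimension. *)
Lemma dim_cap_preim_hyperplane f U H : pg_hyperplane H ->
  (\dim U <= (\dim (U :&: f @^-1: H)).+1)%N.
Proof.
move=> hH; have := dim_cap_hyperplane (f @: U)%VS hH.
rewrite -(limg_ker_dim f U) -(limg_ker_dim f (U :&: f @^-1: H)%VS).
have -> : (U :&: f @^-1: H :&: lker f = U :&: lker f)%VS.
  rewrite -capvA; congr (_ :&: _)%VS; apply/capv_idPr/subvP => x.
  by rewrite memv_ker -memv_preim => /eqP->; exact: mem0v.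
have : (f @: U :&: H <= f @: (U :&: f @^-1: H))%VS.
  apply/subvP => _ /memv_capP[/memv_imgP[x xU ->] fxH].
  by rewrite memv_img // memv_cap xU -memv_preim.
by move/dimvS; lia.
Qed.

Lemma dim_limg_point f p : pg_point p -> (\dim (f @: p) <= 1)%N.
Proof. by rewrite /pg_point => dp; have := limg_ker_dim f p; lia. Qed.

Lemma hyperplane_eq H1 H2 : pg_hyperplane H1 -> pg_hyperplane H2 ->
  (H1 <= H2)%VS -> H1 = H2.
Proof.
rewrite /pg_hyperplane => h1 h2 H12; apply/eqP; rewrite eqEdim H12 /=; lia.
Qed.

End Subspaces.

(** * The hyperplane, lines and codimension-2 subspaces attached to an endomorphism *)

Section Endomorphism.
Variables (F : fieldType) (V : vectType F) (f : 'End(V)).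
Implicit Types (p l H L U W : {vspace V}) (x v : V) (S D : set {vspace V}).

Definition end_hyperplane : set ({vspace V} * {vspace V}) :=
  [set a | flag a /\ (f @: a.1 <= a.2)%VS].

(** Coordinate-free form of [spread_of_mx]; a member is a projective line only when its [p] is not
    fixed by [f]. *)
Definition end_spread : set {vspace V} :=
  [set l | exists2 p, pg_point p & l = (p + f @: p)%VS].

(** The candidate for the member of the dual spread inside [H]: every [f]-stable subspace of [H]
    lies in it. *)
Definition end_core H : {vspace V} := (H :&: f @^-1: H)%VS.

Lemma end_hyperplane_geometric p0 : pg_point p0 -> ~~ (f @: p0 <= p0)%VS ->
  geometric_hyperplane end_hyperplane.
Proof.
move=> dp0 fp0; split.
- split; first by move=> a [].
  (* Properness: a hyperplane through [p0] that misses [f @: p0] gives a flag outside the set. *)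
  have [H [hH p0H fp0H]] := hyperplane_separation fp0.
  by move=> /(_ (p0, H))[] // _ /=; apply/negP.
- move=> Y [[l [H [dl hH lH ->]]] | [p [L [dp dL pL ->]]]].
    (* The vectors of [l] sent into [H] form a subspace of dimension at least 1. *)
    have := dim_cap_preim_hyperplane f l hH; rewrite dl ltnS.
    case/exists_nonzero=> x x0; rewrite memv_cap -memv_preim => /andP[xl fxH].
    have px := pg_point_vline x0; have xH := subvP lH x xl.
    by exists (<[x]>%VS, H); do ?split; rewrite // ?limg_line -memvE.
  (* Since [f @: p] has dimension at most 1, [L + f @: p] still has codimension at least 1. *)
  have [|H hH] := @exists_hyperplane _ _ (L + f @: p)%VS.
    have [+ _] := dimv_add_leqif L (f @: p)%VS; have := dim_limg_point f dp.
    move: dL; rewrite /pg_codim2; lia.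
  rewrite subv_add => /andP[LH fpH].
  by exists (p, H); do ?split; rewrite //= (subv_trans pL).
- move=> Y [[l [H [dl hH lH ->]]] | [p [L [dp dL pL ->]]]]
    [[p1 H1] [[p2 H2] [neq [/= [+ + +] [_ /= f1]] [/= [+ + +] [_ /= f2]]]]].
    move=> dp1 p1l eH1 dp2 p2l eH2; subst H1 H2.
    (* Two distinct points span [l], so [f] sends all of [l] into [H1]. *)
    have dp12 : \dim (p1 :&: p2) = 0%N.
      apply/eqP; rewrite -leqn0 -ltnS -dp1 ltnNge; apply/negP => dle.
      case: neq; congr (_, _).
      have /eqP e1 : (p1 :&: p2 == p1)%VS by rewrite eqEdim capvSl.
      by apply/eqP; rewrite eqEdim -{1}e1 capvSr dp1 dp2.
    have le : (p1 + p2)%VS = l.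
      apply/eqP; rewrite eqEdim subv_add p1l p2l dl /=.
      by have := dimv_sum_cap p1 p2; rewrite dp12 dp1 dp2 addn0 => ->.
    move=> [p H'] [/= dp pl ->]; do ?split; rewrite //= ?(subv_trans pl) //.
    by rewrite (subv_trans (limgS f pl)) // -le limgD subv_add f1 f2.
  move=> e1 hH1 LH1 e2 hH2 LH2; subst p1 p2.
  (* Two distinct hyperplanes above [L] meet in [L], so [f @: p1] lies in [L] and hence in every
     hyperplane above it. *)
  have LE : L = (H1 :&: H2)%VS.
    apply/eqP; rewrite eqEdim subv_cap LH1 LH2 /=.
    have [d|] := leqP (\dim H1) (\dim (H1 :&: H2)).
      case: neq; congr (_, _); apply: hyperplane_eq => //.
      by apply/capv_idPl/eqP; rewrite eqEdim capvSl.
    by move: dL hH1; rewrite /pg_codim2 /pg_hyperplane; lia.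
  move=> [q H] [/= -> hH LH]; do ?split; rewrite //= ?(subv_trans pL) //.
  by rewrite (subv_trans _ LH) // LE subv_cap f1 f2.
Qed.

(** * From stability and the absence of fixed points and hyperplanes to a spread with a dual *)

Section Sufficiency.
Hypothesis fix_pt : forall p, pg_point p -> ~~ (f @: p <= p)%VS.
Hypothesis fix_hyp : forall H, pg_hyperplane H -> ~~ (f @: H <= H)%VS.
Hypothesis stable_line :
  forall p, pg_point p -> (f @: (p + f @: p) <= p + f @: p)%VS.
Hypothesis stable_core :
  forall H, pg_hyperplane H -> (f @: end_core H <= end_core H)%VS.

Lemma end_line_dim p : pg_point p -> pg_line (p + f @: p)%VS.
Proof.
move=> dp; have [d _] := dimv_add_leqif p (f @: p)%VS.
have := dim_limg_point f dp; move: (fix_pt dp); rewrite /pg_line.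
have := dimvS (addvSl p (f @: p)%VS).
rewrite dp in d *; have [d2|] := leqP (\dim (p + f @: p)) 1; last by lia.
have /eqP pE : (p + f @: p == p)%VS by rewrite eq_sym eqEdim addvSl dp.
by move=> _ /negP[]; apply/addv_idPl.
Qed.

(** A member is [f]-stable, so with [p] it contains [f @: p]; both sides have dimension 2. *)
Lemma end_line_eq p l : pg_point p -> end_spread l -> (p <= l)%VS ->
  l = (p + f @: p)%VS.
Proof.
move=> dp [q dq ->] pq; apply/esym/eqP.
rewrite eqEdim (end_line_dim dp) (end_line_dim dq) leqnn andbT subv_add pq /=.
exact: subv_trans (limgS f pq) (stable_line dq).
Qed.

(** Serves both for the whole space and for the members of the dual spread. *)
Lemma end_spread_sub U : (f @: U <= U)%VS ->
  line_spread U [set l | end_spread l /\ (l <= U)%VS].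
Proof.
move=> fU; split=> [l [[p dp ->] ?]|p dp pU].
  by split=> //; exact: end_line_dim.
exists (p + f @: p)%VS; split.
  split; last exact: addvSl.
  by split; [exists p | rewrite subv_add pU (subv_trans (limgS f pU))].
by move=> l [[Sl _] pl]; rewrite (end_line_eq dp Sl pl).
Qed.

Lemma end_spread_line_spread : line_spread fullv end_spread.
Proof.
have := end_spread_sub (subvf (f @: fullv)%VS).
rewrite (_ : [set l | _] = end_spread) //.
by apply/seteqP; split=> [l []//|l Sl]; split=> //; exact: subvf.
Qed.

(** The core loses at most one dimension in [H], and at least one because [H] is not stable. *)
Lemma end_core_codim2 H : pg_hyperplane H -> pg_codim2 (end_core H).
Proof.
move=> hH; have := dim_cap_preim_hyperplane f H hH.
have : (\dim (end_core H) < \dim H)%N.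
  rewrite ltnNge; apply: contra (fix_hyp hH) => d.
  rewrite limg_subE; apply/capv_idPl/eqP.
  by rewrite eqEdim capvSl.
move: hH; rewrite /pg_hyperplane /pg_codim2 /end_core; lia.
Qed.

Lemma end_core_eq H L : pg_hyperplane H -> pg_codim2 L -> (L <= H)%VS ->
  (f @: L <= L)%VS -> L = end_core H.
Proof.
move=> hH dL LH fL; apply/eqP; rewrite eqEdim subv_cap LH -limg_subE.
rewrite (subv_trans fL LH) /=.
by have := end_core_codim2 hH; move: dL; rewrite /pg_codim2; lia.
Qed.

Lemma end_spread_admits_dual : admits_dual end_spread.
Proof.
exists [set L | exists2 H, pg_hyperplane H & L = end_core H]; split.
  split=> [_ [H hH ->]|H hH]; first exact: end_core_codim2.
  exists (end_core H); split; first by split; [exists H | exact: capvSl].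
  (* The core of [K] is a stable codimension-2 subspace of [H], hence also the core of [H]. *)
  move=> _ [[K hK ->] KH]; apply/esym/end_core_eq => //; last exact: stable_core.
  exact: end_core_codim2.
by move=> _ [H hH ->]; exact/end_spread_sub/stable_core.
Qed.

Lemma end_hyperplane_spread : end_hyperplane = spread_hyperplane end_spread.
Proof.
apply/seteqP; split=> [[p H] [[/= dp hH pH] fpH]|[p H] [[/= dp hH pH]]].
  split=> //; exists (p + f @: p)%VS; split=> /=; first by exists p.
    exact: addvSl.
  by rewrite subv_add pH.
move=> [l [Sl pl lH]]; split=> //=; apply: subv_trans lH.
by rewrite (end_line_eq dp Sl pl) addvSr.
Qed.

End Sufficiency.

(** * From a spread defining the hyperplane back to the stability conditions *)

Section Necessity.
Variable S : set {vspace V}.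
Hypothesis spS : line_spread fullv S.
Hypothesis endS : end_hyperplane = spread_hyperplane S.

Lemma spread_line_end p l : pg_point p -> S l -> (p <= l)%VS ->
  l = (p + f @: p)%VS.
Proof.
move=> dp Sl pl.
have SlU l' : S l' -> (p <= l')%VS -> l' = l.
  move=> Sl' pl'; have [m [_ mU]] := spS.2 p dp (subvf _).
  by rewrite -(mU l) // -(mU l').
(* Membership of the flag [(p, H)] is read in both descriptions; [l] is the only member through
   [p]. *)
have HE H : pg_hyperplane H -> (p <= H)%VS -> (f @: p <= H)%VS = (l <= H)%VS.
  move=> hH pH; apply/idP/idP => h.
    have : end_hyperplane (p, H) by [].
    by rewrite endS => -[_ [l' [/= Sl' pl' l'H]]]; rewrite -(SlU l').
  have : spread_hyperplane S (p, H) by split=> //; exists l.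
  by rewrite -endS => -[].
apply/eqP; rewrite eqEsubv; apply/andP; split; apply: subv_hyperplanes => H hH.
  by rewrite subv_add => /andP[pH]; rewrite HE.
by move=> lH; have pH := subv_trans pl lH; rewrite subv_add pH HE.
Qed.

Lemma spread_eq_end : S = end_spread.
Proof.
apply/seteqP; split=> [l Sl|_ [p dp ->]]; last first.
  have [l [[Sl pl] _]] := spS.2 p dp (subvf _).
  by rewrite -(spread_line_end dp Sl pl).
have [dl _] := spS.1 l Sl.
have [|x x0 xl] := @exists_nonzero _ _ l; first by rewrite dl.
have dx := pg_point_vline x0.
by exists <[x]>%VS => //; apply: spread_line_end.
Qed.

Lemma end_no_fixed_point p : pg_point p -> ~~ (f @: p <= p)%VS.
Proof.
move=> dp; have [l [[Sl pl] _]] := spS.2 p dp (subvf _).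
have [dl _] := spS.1 l Sl; apply/negP => /addv_idPl pE; move: dl.
by rewrite (spread_line_end dp Sl pl) pE /pg_line dp.
Qed.

(** The member through [p] is also the member through each of its points [<[y]>], so it contains
    [f y]. *)
Lemma end_line_stable p : pg_point p -> (f @: (p + f @: p) <= p + f @: p)%VS.
Proof.
move=> dp; have [l [[Sl pl] _]] := spS.2 p dp (subvf _).
rewrite -(spread_line_end dp Sl pl); apply/subvP => _ /memv_imgP[y yl ->].
have [->|y0] := eqVneq y 0; first by rewrite linear0 mem0v.
rewrite (spread_line_end (pg_point_vline y0) Sl) -?memvE //.
by rewrite (subvP (addvSr _ _)) // memv_img // memv_line.
Qed.

(** The dual member inside [H] is covered by members of [S] lying in it, hence is stable, and a
    stable codimension-2 subspace of [H] is its core. *)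
Lemma end_core_stable H :
    (forall H, pg_hyperplane H -> ~~ (f @: H <= H)%VS) ->
  admits_dual S -> pg_hyperplane H -> (f @: end_core H <= end_core H)%VS.
Proof.
move=> fix_hyp [D [[dD uD] spD]] hH; have [L [[DL LH] _]] := uD H hH.
have fL : (f @: L <= L)%VS.
  apply/subvP => _ /memv_imgP[y yL ->].
  have [->|y0] := eqVneq y 0; first by rewrite linear0 mem0v.
  have dy := pg_point_vline y0.
  have [|l [[[Sl lL] yl] _]] := (spD L DL).2 _ dy; first by rewrite -memvE.
  move: lL; rewrite (spread_line_end dy Sl yl) => /subvP; apply.
  by rewrite (subvP (addvSr _ _)) // memv_img // memv_line.
by rewrite -(end_core_eq fix_hyp hH (dD L DL) LH fL).
Qed.

End Necessity.
End Endomorphism.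

(** * Column vectors as points, row vectors as hyperplanes *)

Section Coordinates.
Variables (F : fieldType) (n : nat).
Implicit Types (M : 'M[F]_n.+1) (x y : 'cV[F]_n.+1) (xi eta : 'rV[F]_n.+1).

Definition end_of_mx M : 'End('cV[F]_n.+1) := linfun (mulmx M).

Lemma end_of_mxE M x : end_of_mx M x = M *m x.
Proof. exact: lfunE. Qed.

Lemma mem_hyp_of xi x : (x \in hyp_of xi) = (xi *m x == 0).
Proof. by rewrite memv_ker lfunE. Qed.

Lemma hyp_of_hyperplane xi : xi != 0 -> pg_hyperplane (hyp_of xi).
Proof.
move=> xi0; pose g : 'Hom('cV[F]_n.+1, 'M[F]_1) := linfun (mulmx xi).
have := limg_ker_dim g fullv; rewrite capfv /pg_hyperplane => <-.
suff -> : \dim (limg g) = 1%N by rewrite addn1.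
apply/eqP; rewrite eqn_leq; apply/andP; split.
  by rewrite (leq_trans (dimvS (subvf _))) // dimvf dim_matrix.
rewrite lt0n dimv_eq0; apply: contra xi0 => /eqP im0.
apply/eqP/rowP => j.
have := memv_img g (memvf (delta_mx j 0 : 'cV[F]_n.+1)).
rewrite im0 memv0 lfunE /= -colE => /eqP/matrixP/(_ 0 0).
by rewrite !mxE.
Qed.

(** A basis of [H] gives the [n] columns of a matrix with [n.+1] rows, whose left kernel therefore
    contains a nonzero row. *)
Lemma hyp_of_onto (H : {vspace 'cV[F]_n.+1}) : pg_hyperplane H ->
  exists2 xi, xi != 0 & H = hyp_of xi.
Proof.
move=> hH; pose A : 'M_(n.+1, \dim H) := \matrix_(i, j) (vbasis H)`_j i 0.
have dH : \dim H = n.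
  by move: hH; rewrite /pg_hyperplane dimvf dim_matrix => -[->]; rewrite muln1.
have kA : kermx A != 0.
  rewrite -mxrank_eq0 mxrank_ker -lt0n subn_gt0.
  by rewrite (leq_ltn_trans (rank_leq_col _)) // dH.
have xi0 : nz_row (kermx A) != 0 by rewrite nz_row_eq0.
exists (nz_row (kermx A)) => //.
apply: hyperplane_eq => //; first exact: hyp_of_hyperplane.
suff : (<<vbasis H>> <= hyp_of (nz_row (kermx A)))%VS.
  by rewrite (span_basis (vbasisP H)).
apply/span_subvP => v vH.
rewrite mem_hyp_of; have /sub_kermxP/matrixP kxi := nz_row_sub (kermx A).
have [j jlt <-] := nthP 0 vH; rewrite size_tuple in jlt.
apply/eqP/matrixP => a b; rewrite !ord1; have := kxi 0 (Ordinal jlt).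
rewrite !mxE => e; rewrite -[RHS]e; apply: eq_bigr => i _.
by rewrite !mxE.
Qed.

Lemma tensor_hyperplaneE M : tensor_hyperplane M = end_hyperplane (end_of_mx M).
Proof.
apply/seteqP; split=> [_ [x [xi [x0 xi0 -> xix xiMx]]]|[p H] [[/= dp hH]]].
  split=> /=; last first.
    by rewrite limg_line -memvE mem_hyp_of end_of_mxE mulmxA xiMx.
  split=> /=; [exact: pg_point_vline | exact: hyp_of_hyperplane |].
  by rewrite -memvE mem_hyp_of xix.
have [x x0 ->] := pg_pointP dp; have [xi xi0 ->] := hyp_of_onto hH.
rewrite limg_line -!memvE !mem_hyp_of end_of_mxE mulmxA => /eqP xix /eqP xiMx.
by exists x, xi.
Qed.

Lemma spread_of_mxE M : spread_of_mx M = end_spread (end_of_mx M).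
Proof.
apply/seteqP; split=> [_ [x x0 ->]|_ [p dp ->]].
  by exists <[x]>%VS; [exact: pg_point_vline | rewrite limg_line end_of_mxE].
have [x x0 ->] := pg_pointP dp.
by exists x => //; rewrite limg_line end_of_mxE.
Qed.

Lemma mem_span2 (V : vectType F) (u v w : V) :
  reflect (exists a b, w = a *: u + b *: v) (w \in <<[:: u; v]>>%VS).
Proof.
rewrite span_cons span_seq1; apply: (iffP memv_addP).
  by case=> _ /vlineP[a ->] [_ /vlineP[b ->] ->]; exists a, b.
case=> a [b ->]; exists (a *: u); first by rewrite memvZ // memv_line.
by exists (b *: v); first by rewrite memvZ // memv_line.
Qed.

(* Double annihilator, through the columns of [cokermx]. *)
Lemma span2_annihilator xi eta zeta :
  (forall x, xi *m x = 0 -> eta *m x = 0 -> zeta *m x = 0) ->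
  exists a b, zeta = a *: xi + b *: eta.
Proof.
move=> ann; have : (zeta <= col_mx xi eta)%MS.
  rewrite submxE; apply/eqP/rowP => j; set K := cokermx _.
  have : col_mx xi eta *m (K *m delta_mx j 0 : 'cV_n.+1) = 0.
    by rewrite mulmxA mulmx_coker mul0mx.
  rewrite mul_col_mx -[0 in RHS]col_mx0 => /eq_col_mx[e1 e2].
  have /matrixP/(_ 0 0) := ann _ e1 e2.
  by rewrite mulmxA -colE mxE => ->; rewrite !mxE.
case/submxP=> D; rewrite -[D]hsubmxK mul_row_col => ->.
rewrite (mx11_scalar (lsubmx D)) (mx11_scalar (rsubmx D)) !mul_scalar_mx.
by eexists; eexists.
Qed.

(** [eigenvalue] refers to row eigenvectors; transposing gives access to column eigenvectors, that
    is, to fixed points. *)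
Lemma eigenvalue_tr M a : eigenvalue M^T a = eigenvalue M a.
Proof.
rewrite !eigenvalue_root_char; congr root.
rewrite /char_poly -det_tr; congr (\det _).
by rewrite /char_poly_mx linearB /= tr_scalar_mx map_trmx trmxK.
Qed.

Lemma fixed_point_eigenvalue M :
  (exists a, eigenvalue M a) <->
  exists2 p, pg_point p & (end_of_mx M @: p <= p)%VS.
Proof.
split=> [[a]|[p dp]].
  rewrite -eigenvalue_tr => /eigenvalueP[v vM v0].
  exists <[v^T]>%VS; first by apply: pg_point_vline; rewrite trmx_eq0.
  rewrite limg_line -memvE end_of_mxE -[M]trmxK -trmx_mul vM linearZ.
  by rewrite memvZ // memv_line.
have [x x0 ->] := pg_pointP dp.
rewrite limg_line -memvE end_of_mxE => /vlineP[a Mx].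
exists a; rewrite -eigenvalue_tr; apply/eigenvalueP; exists x^T.
  by rewrite -trmx_mul Mx linearZ.
by rewrite trmx_eq0.
Qed.

Lemma fixed_hyperplane_eigenvalue M (H : {vspace 'cV[F]_n.+1}) :
  pg_hyperplane H -> (end_of_mx M @: H <= H)%VS -> exists a, eigenvalue M a.
Proof.
move=> hH; have [xi xi0 ->] := hyp_of_onto hH; rewrite limg_subE => /subvP fH.
(* With second row 0: [xi *m M] vanishes on the kernel of [xi], so it is a multiple of [xi]. *)
have [|a [b xiM]] := @span2_annihilator xi 0 (xi *m M).
  move=> x xix _; have := fH x; rewrite -memv_preim !mem_hyp_of end_of_mxE.
  by rewrite mulmxA xix eqxx => /(_ isT)/eqP.
by exists a; apply/eigenvalueP; exists xi; rewrite ?xiM ?scaler0 ?addr0.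
Qed.

(** For [p = <[x]>] the image of the line is spanned by [M *m x] and [M ^+ 2 *m x], and only the
    latter can leave the line. *)
Lemma column_stable M :
  (forall x, x != 0 -> M ^+ 2 *m x \in <<[:: x; M *m x]>>%VS) <->
  (forall p, pg_point p ->
     (end_of_mx M @: (p + end_of_mx M @: p) <= p + end_of_mx M @: p)%VS).
Proof.
split=> [cM p dp|sM x x0].
  have [x x0 ->] := pg_pointP dp; have := cM x x0.
  rewrite limgD !limg_line !end_of_mxE subv_add addvSr /= -memvE.
  by rewrite span_cons span_seq1 expr2 -mulmxE mulmxA.
have := sM _ (pg_point_vline x0).
rewrite limgD !limg_line !end_of_mxE subv_add addvSr /= -memvE.
by rewrite span_cons span_seq1 expr2 -mulmxE mulmxA.
Qed.

(** The core of [hyp_of xi] is the common kernel of [xi] and [xi *m M]; it is stable exactly when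
    [xi *m M ^+ 2] vanishes on it, and the double annihilator turns this into a span. *)
Lemma row_stable M :
  (forall xi, xi != 0 -> xi *m M ^+ 2 \in <<[:: xi; xi *m M]>>%VS) <->
  (forall H, pg_hyperplane H ->
     (end_of_mx M @: end_core (end_of_mx M) H <= end_core (end_of_mx M) H)%VS).
Proof.
have coreP xi x : (x \in end_core (end_of_mx M) (hyp_of xi)) =
    (xi *m x == 0) && (xi *m M *m x == 0).
  by rewrite memv_cap -memv_preim !mem_hyp_of end_of_mxE mulmxA.
split=> [rM H hH|sM xi xi0].
  have [xi xi0 ->] := hyp_of_onto hH; have /mem_span2[a [b e]] := rM xi xi0.
  rewrite limg_subE; apply/subvP => x; rewrite -memv_preim !coreP end_of_mxE.
  case/andP=> /eqP e0 /eqP e1; rewrite !mulmxA e1 eqxx /=.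
  rewrite -[xi *m M *m M]mulmxA mulmxE -expr2 e.
  by rewrite mulmxDl -!scalemxAl e0 e1 !scaler0 addr0.
apply/mem_span2/span2_annihilator => x e0 e1.
have /subvP := sM _ (hyp_of_hyperplane xi0) => /(_ (M *m x)).
rewrite coreP -end_of_mxE memv_img; last by rewrite coreP e0 e1 eqxx.
rewrite end_of_mxE !mulmxA => /(_ isT)/andP[_ /eqP].
by rewrite -[xi *m M *m M]mulmxA mulmxE -expr2.
Qed.

End Coordinates.

(** * Spread type expressed by eigenvalues and span conditions on the matrix *)

Theorem theorem1p15 (F : fieldType) (n : nat) (M : 'M[F]_n.+1)
    (n_ge2 : (2 <= n)%N) (M_nonscalar : ~~ is_scalar_mx M) :
  (spread_type (tensor_hyperplane M) <->
     [/\ forall a : F, ~~ eigenvalue M a,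
         forall x : 'cV[F]_n.+1, x != 0 ->
           M ^+ 2 *m x \in <<[:: x; M *m x]>>%VS &
         forall xi : 'rV[F]_n.+1, xi != 0 ->
           xi *m M ^+ 2 \in <<[:: xi; xi *m M]>>%VS]) /\
  (spread_type (tensor_hyperplane M) ->
     [/\ line_spread fullv (spread_of_mx M),
         admits_dual (spread_of_mx M) &
         tensor_hyperplane M = spread_hyperplane (spread_of_mx M)]).
Proof.
rewrite tensor_hyperplaneE spread_of_mxE; split; last first.
  (* The spread is forced, so the given [S] is already the spread of [M] and its properties carry
     over. *)
  by case=> _ [S [spS dS eS]]; rewrite -(spread_eq_end spS eS).
split=> [[_ [S [spS dS eS]]] | [noeig /column_stable sl /row_stable sc]].
  have noeig a : ~~ eigenvalue M a.
    apply/negP => eig.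
    have [p dp] : exists2 p, pg_point p & (end_of_mx M @: p <= p)%VS.
      by apply/fixed_point_eigenvalue; exists a.
    exact/negP/(end_no_fixed_point spS eS).
  split=> //; first exact/column_stable/(end_line_stable spS eS).
  apply/row_stable => H hH; apply: (end_core_stable spS eS) => // K hK.
  by apply/negP => /(fixed_hyperplane_eigenvalue hK)[a]; apply/negP.
have fp p : pg_point p -> ~~ (end_of_mx M @: p <= p)%VS.
  move=> dp; apply/negP => fp.
  have [|a] := (fixed_point_eigenvalue M).2; first by exists p.
  exact/negP.
have fh H : pg_hyperplane H -> ~~ (end_of_mx M @: H <= H)%VS.
  by move=> hH; apply/negP => /(fixed_hyperplane_eigenvalue hH)[a]; apply/negP.
(* Any point will do as the non-fixed point that makes the hyperplane proper. *)
have [|x x0 _] := @exists_nonzero F 'cV[F]_n.+1 fullv.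
  by rewrite dimvf dim_matrix.
have dx := pg_point_vline x0.
split; first exact: end_hyperplane_geometric dx (fp _ dx).
exists (end_spread (end_of_mx M)); split.
- exact: end_spread_line_spread.
- exact: end_spread_admits_dual.
- exact: end_hyperplane_spread.
Qed.
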